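(* Let $|E|$ be finite and $\gamma>0$. For any $K\ge 1$, $$\mathbb{E}\big\langle (M(\sigma)-\langle M(\sigma)\rangle_y)^2\big\rangle_y\le I(K)+\frac{1}{\gamma\sqrt{|E|}},\qquad I(K):=\frac{8}{|E|}\sum_{e\in E}\mathbb{E}\big[|y_e|^2;|y_e|\ge K\big]+9\gamma K .$$ In addition, if $B_3:=\max_{e\in E}\mathbb{E}|y_e|^3<\infty$, then $$\mathbb{E}\big\langle (M(\sigma)-\langle M(\sigma)\rangle_y)^2\big\rangle_y\le 9B_3\gamma+\frac{1}{\gamma\sqrt{|E|}} .$$
   Context: $\Sigma$ is a finite set and $\mu$ is a random (nonzero, finite) measure on $\Sigma$. $E$ is an index set, $(f_e)_{e\in E}$ is a family of measurable functions on $\Sigma$ with $|f_e|\le 1$, and $(y_e)_{e\in E}$ are independent random variables with mean zero and variance one, all independent of $\mu$. The Hamiltonian is $H_y(\sigma)=\gamma\sum_{e\in E}y_ef_e(\sigma)$, and the (random) Gibbs measure on $\Sigma$ is $dG_y(\sigma)=\exp(H_y(\sigma))\,d\mu(\sigma)/Z_y$, where $Z_y$ is the normalizing factor making it a probability measure. $\langle\cdot\rangle_y$ denotes expectation with respect to $G_y$, and $\mathbb{E}$ denotes expectation with respect to all the randomness in $(y_e)_{e\in E}$ and $\mu$. The magnetization is $M(\sigma)=\frac{1}{|E|}\sum_{e\in E}f_e(\sigma)$. For a random variable $X$ and event $A$, $\mathbb{E}[X;A]=\mathbb{E}[X\mathbf 1_A]$. *)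

(* Defs.v *)
From HB Require Import structures.
From mathcomp Require Import all_boot all_order all_algebra.
From mathcomp Require Import all_classical all_reals all_analysis.
From mathcomp Require Import measurable_realfun.

Set Implicit Arguments.
Unset Strict Implicit.
Unset Printing Implicit Defensive.

Import Order.TTheory GRing.Theory Num.Theory.
Import numFieldNormedType.Exports.

Local Open Scope classical_set_scope.
Local Open Scope ring_scope.

Definition mutually_independent d (T : measurableType d) (R : realType)
    (P : probability T R) (I : finType) (F : I -> set (set T)) : Prop :=
  forall (J : {set I}) (A : I -> set T), (forall i, i \in J -> F i (A i)) ->
    P (\bigcap_(i in [set` J]) A i) = (\prod_(i in J) P (A i))%E.

Definition sigma_rv d (T : measurableType d) (R : realType) (X : T -> R) :
    set (set T) :=
  preimage_set_system [set: T] X (@measurable _ R).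

(* The sigma-algebra of a random measure: the space of measures carries the
   coarsest sigma-algebra making all the evaluations nu |-> nu U measurable. *)
Definition sigma_random_measure d d' (T : measurableType d)
    (S : measurableType d') (R : realType)
    (mu : T -> {measure set S -> \bar R}) : set (set T) :=
  <<s \bigcup_(U in @measurable _ S)
        preimage_set_system [set: T] (fun w => mu w U)
          (@measurable _ (\bar R)) >>.

(* The sigma-algebra of mu sits at index None and that of y e at Some e: mutual
   independence of this family says that the y e are independent of one another
   and that the whole family y is independent of mu. *)
Definition disorder_independent d d' (T : measurableType d)
    (S : measurableType d') (R : realType) (P : probability T R) (E : finType)
    (mu : T -> {measure set S -> \bar R}) (y : E -> T -> R) : Prop :=
  mutually_independent P (fun i : option E =>
    if i is Some e then sigma_rv (y e) else sigma_random_measure mu).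

Definition expectation_on d (T : measurableType d) (R : realType)
    (P : probability T R) (X : T -> R) (A : set T) : \bar R :=
  'E_P[fun w => X w * \1_A w].

Section gibbs_def.
Context d (S : measurableType d) (R : realType) (E : finType).
Variables (nu : {measure set S -> \bar R}) (gamma : R).
Variables (f : E -> {mfun S >-> R}) (y : E -> R).

Definition hamiltonian (s : S) : R := gamma * \sum_(e : E) y e * f e s.

(* \int is real-valued here and in gibbs_avg: it is 0 when the extended-real
   integral is infinite. That does not happen for finite nu and bounded f. *)
Definition partition_function : R := \int[nu]_s expR (hamiltonian s).

Definition gibbs (A : set S) : \bar R :=
  (\int[nu]_(s in A) (expR (hamiltonian s) / partition_function)%:E)%E.

Lemma measurable_hamiltonian : measurable_fun [set: S] hamiltonian.
Proof.
apply: measurable_funM => //; apply: measurable_sum => e.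
exact: measurable_funM.
Qed.

Lemma partition_function_ge0 : 0 <= partition_function.
Proof. by apply: Rintegral_ge0 => s _; exact: expR_ge0. Qed.

Let density_ge0 s : (0 <= (expR (hamiltonian s) / partition_function)%:E)%E.
Proof. by rewrite lee_fin divr_ge0 ?expR_ge0 ?partition_function_ge0. Qed.

Let measurable_density : measurable_fun [set: S]
  (fun s => (expR (hamiltonian s) / partition_function)%:E).
Proof.
apply/measurable_EFinP; apply: measurable_funM => //.
by apply: measurableT_comp => //; exact: measurable_hamiltonian.
Qed.

Let gibbs0 : gibbs set0 = 0%E.
Proof. by rewrite /gibbs integral_set0. Qed.

Let gibbs_ge0 A : (0 <= gibbs A)%E.
Proof. by rewrite /gibbs integral_ge0// => s _. Qed.

Let gibbs_sigma_additive : semi_sigma_additive gibbs.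
Proof.
move=> /= A mA tA mUA; rewrite /gibbs ge0_integral_bigcup//; last first.
  exact: measurable_funTS.
by apply: is_cvg_ereal_nneg_natsum_cond => n _ _; exact: integral_ge0.
Qed.

HB.instance Definition _ := isMeasure.Build _ _ _
  gibbs gibbs0 gibbs_ge0 gibbs_sigma_additive.

Definition gibbs_avg (g : S -> R) : R := \int[gibbs]_s g s.

Definition magnetization (s : S) : R := (\sum_(e : E) f e s) / #|E|%:R.

Definition gibbs_variance_magnetization : R :=
  gibbs_avg (fun s => (magnetization s - gibbs_avg magnetization) ^+ 2).

Lemma gibbs_setT : (nu [set: S] < +oo)%E -> (nu [set: S] != 0)%E ->
  (forall e s, `|f e s| <= 1) -> gibbs [set: S] = 1%E.
Proof.
move=> nuoo nu0 f1.
pose c := `|gamma| * \sum_(e : E) `|y e|.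
have Hc s : `|hamiltonian s| <= c.
  rewrite /hamiltonian normrM ler_wpM2l//.
  apply: (le_trans (ler_norm_sum _ _ _)); apply: ler_sum => e _.
  by rewrite normrM ler_piMr.
have mexp : measurable_fun [set: S] (fun s => (expR (hamiltonian s))%:E).
  apply/measurable_EFinP; apply: measurableT_comp => //.
  exact: measurable_hamiltonian.
have nufin : nu [set: S] \is a fin_num by rewrite ge0_fin_numE.
have Zoo : (\int[nu]_s (expR (hamiltonian s))%:E < +oo)%E.
  apply: (@le_lt_trans _ _ (\int[nu]_s (cst (expR c)%:E s))%E).
    apply: ge0_le_integral => //=.
    move=> s _; rewrite lee_fin ler_expR.
    exact: le_trans (ler_norm _) (Hc s).
  by rewrite integral_cst// lte_mul_pinfty ?lee_fin ?expR_ge0.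
have Z0 : (0 < \int[nu]_s (expR (hamiltonian s))%:E)%E.
  apply: (@lt_le_trans _ _ (\int[nu]_s (cst (expR (- c))%:E s))%E).
    rewrite integral_cst// mule_gt0 ?lte_fin ?expR_gt0//.
    by rewrite lt0e nu0/= measure_ge0.
  apply: ge0_le_integral => //=.
    move=> s _; rewrite lee_fin ler_expR.
    by have := Hc s; rewrite ler_norml => /andP[].
have Zfin : (\int[nu]_s (expR (hamiltonian s))%:E)%E \is a fin_num.
  by rewrite ge0_fin_numE// ltW.
rewrite /gibbs; under eq_integral do rewrite EFinM.
rewrite ge0_integralZr//; last first.
- by rewrite lee_fin invr_ge0 partition_function_ge0.
rewrite -[X in (X * _)%E]fineK// -EFinM divff//.
by rewrite gt_eqF// fine_gt0// Z0.
Qed.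

End gibbs_def.

(* Main.v *)
Require Import Defs.
From HB Require Import structures.
From mathcomp Require Import all_boot all_order all_algebra.
From mathcomp Require Import all_classical all_reals all_analysis.
From mathcomp Require Import measurable_realfun.
From mathcomp Require Import ring lra.

(** Write [F] for the Gibbs average of [M], [N] for the number of couplings, and
let [Cov] be the covariance under the Gibbs measure.  As a function of one
coupling [y_e], the average [F] has derivative [gamma * Cov(f_e, M)].  If [y_e]
were Gaussian, integration by parts would give
[E (y_e F) = gamma * E Cov(f_e, M)]; averaging over [e] turns the right-hand side
into [gamma] times the expected variance of [M], while the left-hand side is
the expectation of [F] times the mean of the [y_e], hence at most [1 / sqrt N]
because [|F| <= 1] and the [y_e] are uncorrelated with variance one.

For a general [y_e] with mean zero and variance one, integration by parts is
replaced by a first-order expansion of [F] at [y_e = 0].  Let [F0] and [c0] be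
the values of [F] and of [Cov(f_e, M)] at [y_e = 0]: they depend only on [mu] and
the other couplings, so they are independent of [y_e].  Therefore
[E (y_e F0) = 0] and [E (y_e ^ 2 c0) = E c0], and
[E (y_e F) - gamma * E Cov(f_e, M)] only involves the Taylor remainder of [F]
and the increment of [Cov(f_e, M)].  Everything is bounded by 1, so these are at
most [min (2 |gamma y_e|) (3 |gamma y_e| ^ 2)] and [3 |gamma y_e|]
([wavg_tilt_taylor] and [wcov_tilt_lipschitz]).  This is
[approximate_integration_by_parts]; summing it over [e] gives
[expected_variance_bound].

The two inequalities of the theorem differ only in how the error
[|y| min (2 |gamma y|) (3 |gamma y| ^ 2) + 3 gamma |gamma y|] is estimated.  With
truncation at [K], the first term of the minimum is used where [|y| >= K] and
the second where [|y| < K]; with a third moment, the second term is used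
everywhere, and [E |y_e| ^ 3 >= 1] absorbs the part of lower order.

Two reductions make this elementary.  As [S] is finite, the functions [f e]
split it into finitely many measurable level sets, and every integral over [S]
becomes a finite weighted sum.  Independence of [y_e] from the sigma-algebra of
[mu] and of the other couplings follows from mutual independence by a
pi-lambda argument, and factorization of expectations from uniqueness of
product measures. *)

Set Implicit Arguments.
Unset Strict Implicit.
Unset Printing Implicit Defensive.

Import Order.TTheory GRing.Theory Num.Theory.
Import numFieldNormedType.Exports.

Local Open Scope classical_set_scope.
Local Open Scope ring_scope.

(** * Weighted averages over a finite index set *)

Section weighted_average.
Context (R : realType) (n : nat).
Implicit Types r f g h : 'I_n -> R.

Definition wavg r g : R := (\sum_i r i * g i) / \sum_i r i.

Definition wcov r f g : R :=
  wavg r (fun i => f i * g i) - wavg r f * wavg r g.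

Definition weight r := (forall i, 0 <= r i) /\ 0 < \sum_i r i.

Lemma wavgD r f g : wavg r (fun i => f i + g i) = wavg r f + wavg r g.
Proof.
rewrite /wavg -mulrDl -big_split/=; congr (_ / _).
by apply: eq_bigr => i _; rewrite mulrDr.
Qed.

Lemma wavgZ r a f : wavg r (fun i => a * f i) = a * wavg r f.
Proof.
rewrite /wavg mulrA mulr_sumr; congr (_ / _).
by apply: eq_bigr => i _; rewrite mulrCA.
Qed.

Lemma wavg_sum (E : finType) r (F : E -> 'I_n -> R) :
  wavg r (fun i => \sum_e F e i) = \sum_e wavg r (F e).
Proof.
rewrite /wavg -mulr_suml exchange_big/=; congr (_ / _).
by apply: eq_bigr => i _; rewrite mulr_sumr.
Qed.

Lemma wavg_cst r a : weight r -> wavg r (fun=> a) = a.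
Proof.
by case=> _ r0; rewrite /wavg -mulr_suml mulrAC divff ?gt_eqF// mul1r.
Qed.

Lemma wavg_ge0 r f : weight r -> (forall i, 0 <= f i) -> 0 <= wavg r f.
Proof.
case=> r0 sr f0; apply: divr_ge0; last exact: ltW.
by apply: sumr_ge0 => i _; exact: mulr_ge0.
Qed.

Lemma le_wavg r f g : weight r -> (forall i, f i <= g i) ->
  wavg r f <= wavg r g.
Proof.
move=> rw fg; rewrite -subr_ge0 -[X in _ - X]mul1r -mulNr -wavgZ -wavgD.
by apply: wavg_ge0 => // i; rewrite mulN1r subr_ge0.
Qed.

Lemma norm_wavg_le1 r f : weight r -> (forall i, `|f i| <= 1) ->
  `|wavg r f| <= 1.
Proof.
move=> rw f1; have f1' i : - 1 <= f i <= 1 by rewrite -ler_norml.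
rewrite ler_norml; apply/andP; split.
  rewrite -[leLHS](wavg_cst _ rw); apply: le_wavg => // i.
  by have /andP[] := f1' i.
rewrite -[leRHS](wavg_cst _ rw); apply: le_wavg => // i.
by have /andP[] := f1' i.
Qed.

Lemma wvar_ge0 r f : weight r -> 0 <= wcov r f f.
Proof.
move=> rw; set a := wavg r f.
have : 0 <= wavg r (fun i => f i * f i + (- (2 * a) * f i + a ^+ 2)).
  apply: wavg_ge0 => // i.
  by rewrite (_ : _ + _ = (f i - a) ^+ 2) ?sqr_ge0//; ring.
by rewrite !wavgD wavgZ wavg_cst// /wcov -/a; nra.
Qed.

Lemma wvar_le1 r f : weight r -> (forall i, `|f i| <= 1) -> wcov r f f <= 1.
Proof.
move=> rw f1; rewrite /wcov.
have : wavg r (fun i => f i * f i) <= 1.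
  rewrite -(wavg_cst 1 rw); apply: le_wavg => // i.
  by have := f1 i; rewrite ler_norml => /andP[]; nra.
by nra.
Qed.

Lemma wcov_sumZl (E : finType) r a (F : E -> 'I_n -> R) g :
  wcov r (fun i => a * \sum_e F e i) g = a * \sum_e wcov r (F e) g.
Proof.
rewrite /wcov (_ : (fun i => _ * g i) =
    (fun i => a * \sum_e F e i * g i)); last first.
  by apply/funext => i; rewrite -mulr_suml mulrA.
by rewrite !wavgZ !wavg_sum sumrB mulrBr -mulrA mulr_suml.
Qed.

(** Polarization: the variances of [f + g] and [f - g] are nonnegative, and those
of [f] and [g] are at most 1.  The constant 1 matters: with 2 in its place, the
third-moment error would be [12 gamma E |y| ^ 3] instead of [6 gamma E |y| ^ 3],
while the theorem allows the factor 9. *)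
Lemma norm_wcov_le1 r f g : weight r -> (forall i, `|f i| <= 1) ->
  (forall i, `|g i| <= 1) -> `|wcov r f g| <= 1.
Proof.
move=> rw f1 g1.
have vf := wvar_le1 rw f1; have vg := wvar_le1 rw g1.
have H a : wcov r (fun i => f i + a * g i) (fun i => f i + a * g i) =
    wcov r f f + 2 * a * wcov r f g + a ^+ 2 * wcov r g g.
  rewrite /wcov (_ : (fun i => (_ + _) * _) = (fun i => f i * f i +
    (2 * a * (f i * g i) + a ^+ 2 * (g i * g i)))); last first.
    by apply/funext => i; ring.
  by rewrite !wavgD !wavgZ; ring.
have := wvar_ge0 (fun i => f i + 1 * g i) rw.
have := wvar_ge0 (fun i => f i + (-1) * g i) rw.
by rewrite !H ler_norml; lra.
Qed.

End weighted_average.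

(** * Exponential tilting *)

Section tilting.
Context (R : realType) (n : nat).
Implicit Types r f g h : 'I_n -> R.

(** The Gibbs weights as a function of a single coupling: [f] is the function
that this coupling multiplies, and [t] is [gamma] times its value. *)
Definition tilt r f (t : R) : 'I_n -> R := fun i => r i * expR (t * f i).

Lemma tilt0 r f : tilt r f 0 = r.
Proof. by apply/funext => i; rewrite /tilt mul0r expR0 mulr1. Qed.

Lemma tilt_weight r f t : weight r -> weight (tilt r f t).
Proof.
case=> r0 sr; split; first by move=> i; rewrite mulr_ge0 ?expR_ge0.
rewrite lt_neqAle sumr_ge0 ?andbT; last first.
  by move=> i _; rewrite mulr_ge0 ?expR_ge0.
rewrite eq_sym psumr_neq0; last by move=> i _; rewrite mulr_ge0 ?expR_ge0.
have : \sum_i r i != 0 by rewrite gt_eqF.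
rewrite psumr_neq0// => /hasP[i ii /= ri]; apply/hasP; exists i => //=.
by rewrite mulr_gt0 ?expR_gt0.
Qed.

Lemma is_derive_tilt_sum r f g (t : R) :
  is_derive t 1 (fun t => \sum_i tilt r f t i * g i)
    (\sum_i tilt r f t i * (f i * g i)).
Proof.
rewrite (_ : (fun t => _) = \sum_i (fun t => tilt r f t i * g i)); last first.
  by apply/funext => s; rewrite fct_sumE.
apply: is_derive_sum => i.
have -> : (fun t => tilt r f t i * g i) =
    (r i * g i) *: (expR \o (fun t => t * f i)).
  by apply/funext => s; rewrite /tilt/= [RHS]mulrAC.
have e : is_derive t 1 (fun t : R => t * f i) (f i).
  have -> : (fun t : R => t * f i) = f i *: (@id R).
    by apply/funext => s; rewrite mulrC.
  by apply: is_derive_eq; rewrite /GRing.scale/= mulr1.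
have := @is_derive1_comp _ expR (fun t => t * f i) t _ _ (is_derive_expR _) e.
move=> H; apply: is_derive_eq.
by rewrite /tilt /GRing.scale/=; ring.
Qed.

(** The derivative of the quotient is a covariance because differentiating the
numerator and the denominator each brings down one factor [f]. *)
Lemma is_derive_wavg_tilt r f g (t : R) : weight r ->
  is_derive t 1 (fun t => wavg (tilt r f t) g) (wcov (tilt r f t) f g).
Proof.
move=> rw.
pose D s := \sum_i tilt r f s i * (fun=> 1) i.
have DE s : D s = \sum_i tilt r f s i by apply: eq_bigr => i _; rewrite mulr1.
have D0 s : D s != 0 by rewrite DE gt_eqF//; case: (tilt_weight f s rw).
have dD : is_derive t 1 D _ := is_derive_tilt_sum r f (fun=> 1) t.
have dN := is_derive_tilt_sum r f g t.
have dV := is_deriveV (D0 t) dD.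
have -> : (fun t => wavg (tilt r f t) g) =
    (fun t => \sum_i tilt r f t i * g i) * (fun t => (D t)^-1).
  by apply/funext => s; rewrite /wavg -DE.
apply: is_derive_eq.
rewrite /GRing.scale/= /wcov /wavg -DE.
rewrite (_ : \sum_i tilt r f t i * (f i * 1) = \sum_i tilt r f t i * f i);
  last by apply: eq_bigr => i _; rewrite mulr1.
by have := D0 t; move=> d0; field.
Qed.

Lemma wavg_tilt_mvt r f g t : weight r -> exists s,
  `|s| <= `|t| /\
  wavg (tilt r f t) g - wavg r g = wcov (tilt r f s) f g * t.
Proof.
move=> rw.
have dF (s : R) : is_derive s 1 (fun t => wavg (tilt r f t) g)
    (wcov (tilt r f s) f g).
  exact: is_derive_wavg_tilt.
have cF a b : {within `[a, b], continuous (fun t => wavg (tilt r f t) g)}.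
  apply: continuous_subspaceT => s.
  apply: differentiable_continuous; apply/derivable1_diffP.
  by case: (dF s).
have [t0|t0] := leP 0 t.
  have [c] := MVT_segment t0 (fun s _ => dF s) (cF 0 t).
  rewrite in_itv/= => /andP[c0 ct]; rewrite tilt0 subr0 => ->.
  by exists c; split => //; rewrite !ger0_norm// (le_trans c0).
have [c] := MVT_segment (ltW t0) (fun s _ => dF s) (cF t 0).
rewrite in_itv/= => /andP[tc c0]; rewrite tilt0 sub0r => H.
exists c; split; last by rewrite -opprB H mulrN opprK.
by rewrite !ler0_norm// ?lerN2// ltW.
Qed.

Lemma wavg_tilt_lipschitz r f g t : weight r -> (forall i, `|f i| <= 1) ->
  (forall i, `|g i| <= 1) -> `|wavg (tilt r f t) g - wavg r g| <= `|t|.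
Proof.
move=> rw f1 g1; have [s [_ ->]] := wavg_tilt_mvt f g t rw.
rewrite normrM ler_piMl//; apply: norm_wcov_le1 => //.
exact: tilt_weight.
Qed.

(** The covariance is built from the averages of [f * g], [f] and [g], each of
them 1-Lipschitz in [t] and bounded by 1. *)
Lemma wcov_tilt_lipschitz r f g t : weight r -> (forall i, `|f i| <= 1) ->
  (forall i, `|g i| <= 1) -> `|wcov (tilt r f t) f g - wcov r f g| <= 3 * `|t|.
Proof.
move=> rw f1 g1; have tw := tilt_weight f t rw.
have fg1 i : `|f i * g i| <= 1 by rewrite normrM mulr_ile1.
have := wavg_tilt_lipschitz t rw f1 fg1.
have := wavg_tilt_lipschitz t rw f1 f1.
have := wavg_tilt_lipschitz t rw f1 g1.
have := norm_wavg_le1 tw f1; have := norm_wavg_le1 rw g1.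
rewrite /wcov; move: (wavg _ _) (wavg r g) => a b.
move: (wavg (tilt r f t) _) (wavg (tilt r f t) _) (wavg r _) (wavg r _).
move=> c d e x b1 a1 H1 H2 H3.
have H4 : `|a * (d - b)| <= `|t|.
  by rewrite normrM -[leRHS]mul1r ler_pM.
have H5 : `|b * (a - x)| <= `|t|.
  by rewrite normrM -[leRHS]mul1r ler_pM.
have -> : c - a * d - (e - x * b) = (c - e) - a * (d - b) - b * (a - x).
  by ring.
have := ler_normB (c - e - a * (d - b)) (b * (a - x)).
have := ler_normB (c - e) (a * (d - b)).
by lra.
Qed.

(** The remainder equals [t] times an increment of the covariance, by the mean
value theorem; this gives the quadratic bound.  The linear bound, better for
large [t], holds because the average is 1-Lipschitz. *)
Lemma wavg_tilt_taylor r f g t : weight r -> (forall i, `|f i| <= 1) ->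
  (forall i, `|g i| <= 1) ->
  `|wavg (tilt r f t) g - wavg r g - wcov r f g * t| <=
  Num.min (2 * `|t|) (3 * `|t| ^+ 2).
Proof.
move=> rw f1 g1; rewrite le_min; apply/andP; split.
  have := ler_normB (wavg (tilt r f t) g - wavg r g) (wcov r f g * t).
  have := wavg_tilt_lipschitz t rw f1 g1.
  have : `|wcov r f g * t| <= `|t|.
    by rewrite normrM ler_piMl// norm_wcov_le1.
  by lra.
have [s [st ->]] := wavg_tilt_mvt f g t rw.
rewrite -mulrBl normrM expr2 mulrA ler_wpM2r//.
by rewrite (le_trans (wcov_tilt_lipschitz s rw f1 g1))// ler_wpM2l.
Qed.

End tilting.

(** * Independence and factorization of expectations *)

Section independence.
Context d (T : measurableType d) (R : realType) (P : probability T R).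

(** The intersections of one event per sigma-algebra of index different from [k]
form a pi-system generating the joint sigma-algebra; on it the formula is mutual
independence.  For fixed [B] both sides are finite measures in [A], so agreement
extends to the generated sigma-algebra. *)
Lemma mutually_independent_complement (I : finType) (F : I -> set (set T))
    (k : I) (A B : set T) :
  (forall i, sigma_algebra setT (F i)) -> (forall i, F i `<=` measurable) ->
  mutually_independent P F ->
  <<s \bigcup_(i in [set i | i != k]) F i >> A -> F k B ->
  P (A `&` B) = (P A * P B)%E.
Proof.
move=> sF mF indF sA FB; have mB := mF _ _ FB.
have FT i : F i setT.
  by rewrite -(setD0 setT); have [F0 FC _] := sF i; exact: FC.
have FI i : setI_closed (F i).
  move=> A1 A2; rewrite -(sigma_algebra_id (sF i)).
  exact: (@measurableI _ (g_sigma_algebraType (F i))).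
pose C := [set \bigcap_(i in [set i | i != k]) H i |
  H in [set H : I -> set T | forall i, F i (H i)]].
have CI : setI_closed C.
  move=> _ _ [H1 FH1 <-] [H2 FH2 <-].
  by exists (fun i => H1 i `&` H2 i); [move=> i; exact: FI|rewrite bigcapI].
have Cm : C `<=` measurable.
  move=> _ [H FH <-]; apply: fin_bigcap_measurable => [|i _].
    exact: finite_finset.
  exact: mF.
have CT : C setT by exists (fun=> setT) => //; exact: bigcapT.
have CF : <<s \bigcup_(i in [set i | i != k]) F i >> `<=` <<s C >>.
  apply: smallest_sub; first exact: smallest_sigma_algebra.
  move=> D [i /= ik FiD]; apply: sub_sigma_algebra.
  exists (fun j => if j == i then D else setT).
    by move=> j; case: eqP => [->|].
  apply/seteqP; split=> [x Dx|x Dx j _]; first by have := Dx i ik; rewrite eqxx.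
  by case: eqP.
pose pB : {nonneg R} := NngNum (fine_ge0 (measure_ge0 P B)).
have pBE : (pB%:num)%:E = P B by rewrite /= fineK// fin_num_measure.
rewrite -[LHS]/(mrestr P mB A) muleC -pBE -[RHS]/(mscale pB P A).
apply: (g_sigma_algebra_measure_unique C Cm (fun=> setT)) => //.
- by rewrite bigcup_const.
- move=> _ [H FH <-] /=; rewrite /mrestr/mscale pBE.
  rewrite (_ : _ `&` B = \bigcap_(i in [set` [set: I]%SET])
      (if i == k then B else H i)); last first.
    apply/seteqP; split=> [x [Hx Bx] i _|x Hx].
      by case: eqP => // /eqP ik; exact: Hx.
    split=> [i ik|].
      by have := Hx i; rewrite (negbTE ik); apply; rewrite /= inE.
    by have := Hx k; rewrite eqxx; apply; rewrite /= inE.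
  rewrite indF; last by move=> i _; case: eqP => [->|].
  rewrite (bigD1 k)//= eqxx; congr (_ * _)%E.
  rewrite (_ : [set i | i != k] = [set` [set~ k]%SET]); last first.
    by apply/seteqP; split=> i /=; rewrite !inE.
  rewrite indF//; by apply: eq_big => [i|i /andP[_ /negbTE ->]]; rewrite ?inE.
- move=> _; apply: (@le_lt_trans _ _ 1%E); last exact: ltry.
  by apply: probability_le1; rewrite setTI.
- exact: CF.
Qed.

(** The joint law of [(U, V)] agrees with the product of the marginal laws on
rectangles, hence everywhere; Fubini's theorem then gives the factorization. *)
Lemma independent_expectationM d1 d2 (T1 : measurableType d1)
    (T2 : measurableType d2) (U : {mfun T >-> T1}) (V : {mfun T >-> T2})
    (g : T1 -> R) (h : T2 -> R) :
  (forall A B, measurable A -> measurable B ->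
    P (U @^-1` A `&` V @^-1` B) = P (U @^-1` A) * P (V @^-1` B))%E ->
  measurable_fun setT g -> measurable_fun setT h ->
  P.-integrable setT (EFin \o (g \o U)) ->
  P.-integrable setT (EFin \o (h \o V)) ->
  P.-integrable setT (EFin \o (fun w => g (U w) * h (V w))) /\
  \int[P]_w (g (U w) * h (V w)) = \int[P]_w g (U w) * \int[P]_w h (V w).
Proof.
move=> ind mg mh ig ih.
have mUV : measurable_fun setT (fun w => (U w, V w)).
  exact: measurable_fun_pair.
pose UV : {mfun T >-> (T1 * T2)%type} := mfun_Sub (mem_set mUV).
pose m1 := distribution P U; pose m2 := distribution P V.
have m12 X : measurable X -> (m1 \x m2)%E X = distribution P UV X.
  by apply: product_measure_unique => A B mA mB; exact: ind.
pose F z : \bar R := (g z.1 * h z.2)%:E.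
have mF : measurable_fun setT F.
  by apply/measurable_EFinP; apply: measurable_funM; exact: measurableT_comp.
have mgE : measurable_fun setT (EFin \o g) by exact/measurable_EFinP.
have mhE : measurable_fun setT (EFin \o h) by exact/measurable_EFinP.
have ig' : m1.-integrable setT (EFin \o g) by exact: integrable_pushforward.
have ih' : m2.-integrable setT (EFin \o h) by exact: integrable_pushforward.
have iF : (m1 \x m2)%E.-integrable setT F.
  apply/integrable12ltyP => //.
  have /integrableP[_ hoo] := ih'; have /integrableP[_ goo] := ig'.
  rewrite (eq_integral
    (fun x => `|(g x)%:E| * \int[m2]_y `|(h y)%:E|)%E); last first.
    move=> x _; rewrite -ge0_integralZl//; last exact: measurableT_comp.
    by apply: eq_integral => y _; rewrite /F/= normrM EFinM.
  rewrite ge0_integralZr//; last 2 first.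
  - exact: measurableT_comp.
  - exact: integral_ge0.
  by rewrite lte_mul_pinfty ?integral_ge0// ge0_fin_numE ?integral_ge0.
have dF : (distribution P UV).-integrable setT F.
  apply/integrableP; split => //; have /integrableP[_] := iF.
  by rewrite (eq_measure_integral (distribution P UV))// => A mA _; exact: m12.
have iP : P.-integrable setT (EFin \o (fun w => g (U w) * h (V w))).
  apply/integrableP; split.
    by apply/measurable_EFinP; apply: measurable_funM; exact: measurableT_comp.
  have /integrableP[_] := dF; rewrite ge0_integral_pushforward//.
  exact: measurableT_comp.
split => //; rewrite /Rintegral.
have -> : (\int[P]_w (g (U w) * h (V w))%:E)%E = (\int[m1 \x m2]_z F z)%E.
  rewrite (eq_measure_integral (distribution P UV)); last first.
    by move=> A mA _; exact: m12.
  by rewrite integral_pushforward.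
rewrite -integral12_prod_meas1// /fubini_F.
have g1 : (\int[m1]_x (g x)%:E = \int[P]_w (g (U w))%:E)%E.
  by rewrite integral_pushforward.
have h1 : (\int[m2]_x (h x)%:E = \int[P]_w (h (V w))%:E)%E.
  by rewrite integral_pushforward.
have fh : (\int[P]_w (h (V w))%:E)%E \is a fin_num by exact: integrable_fin_num.
have fg : (\int[P]_w (g (U w))%:E)%E \is a fin_num by exact: integrable_fin_num.
rewrite (eq_integral (fun x => (g x)%:E * \int[m2]_y (h y)%:E)%E); last first.
  move=> x _; rewrite -integralZl//.
rewrite h1 -(fineK fh) integralZr// g1 -[in LHS](fineK fg) -EFinM.
by [].
Qed.

End independence.

(** * Reduction of Gibbs averages to finite sums *)

Section integral_sums.
Context d (T : measurableType d) (R : realType).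
Variable m : {measure set T -> \bar R}.

Lemma integrable_Rintegral_sum (I : Type) (s : seq I) (F : I -> T -> R) :
  (forall i, m.-integrable setT (EFin \o F i)) ->
  m.-integrable setT (EFin \o (fun x => \sum_(i <- s) F i x)) /\
  \int[m]_x (\sum_(i <- s) F i x) = \sum_(i <- s) \int[m]_x F i x.
Proof.
move=> iF; elim: s => [|i s [IH1 IH2]].
  rewrite big_nil (_ : (fun x => \sum_(i <- [::]) F i x) = cst 0); last first.
    by apply/funext => x; rewrite big_nil.
  split; first exact: integrable0.
  by rewrite /Rintegral integral0.
have -> : (fun x => \sum_(j <- i :: s) F j x) =
    (fun x => F i x + \sum_(j <- s) F j x).
  by apply/funext => x; rewrite big_cons.
rewrite big_cons -IH2 -RintegralD//; split => //.
exact: (integrableD measurableT (iF i) IH1).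
Qed.

Lemma bounded_integrable (f : T -> R) (c : R) : (m setT < +oo)%E ->
  measurable_fun setT f -> (forall x, `|f x| <= c) ->
  m.-integrable setT (EFin \o f).
Proof.
move=> moo mf fc; apply: measurable_bounded_integrable => //.
exists c; split; first exact: num_real.
by move=> x cx t _ /=; rewrite (le_trans (fc t)) ?ltW.
Qed.

End integral_sums.

Section finite_gibbs.
Context d (S : measurableType d) (R : realType) (E : finType).
Variable f : E -> {mfun S >-> R}.

Definition level n (v : 'I_n -> E -> R) (i : 'I_n) : set S :=
  [set s | forall e, f e s = v i e].

(** The points of [S] are grouped by the values of all the [f e]: singletons of
[S] need not be measurable, whereas level sets of the [f e] are. *)
Lemma finite_configurations : finite_set [set: S] ->
  exists n (v : 'I_n -> E -> R), injective v /\
    (forall s, exists i, level v i s) /\ (forall i, level v i !=set0).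
Proof.
move=> fS; pose spin s : {ffun E -> R} := [ffun e => f e s].
have /finite_seqP[V0 V0E] : finite_set (spin @` setT) by exact: finite_image.
pose V := undup V0.
pose v (i : 'I_(size V)) e := nth [ffun=> 0] V i e.
exists (size V), v; split; last split.
- move=> i j vij; apply/val_inj/eqP.
  rewrite -(nth_uniq [ffun=> 0] (ltn_ord i) (ltn_ord j) (undup_uniq V0)).
  by apply/eqP/ffunP => e; have := congr1 (fun g => g e) vij.
- move=> s; have sV : spin s \in V.
    by rewrite mem_undup; have : (spin @` setT) (spin s) by [exists s];
      rewrite V0E.
  have iV : (index (spin s) V < size V)%N by rewrite index_mem.
  by exists (Ordinal iV) => e; rewrite /v/= nth_index// ffunE.
- move=> i; have : nth [ffun=> 0] V i \in V0 by rewrite -mem_undup mem_nth.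
  have : [set` V0] = spin @` setT by [].
  move/seteqP => [+ _] => /[apply] -[s _ sE].
  by exists s => e; rewrite /v -sE ffunE.
Qed.

Section fixed_configurations.
Variables (n : nat) (v : 'I_n -> E -> R).
Hypothesis v_inj : injective v.
Hypothesis v_cover : forall s, exists i, level v i s.

Lemma measurable_level i : measurable (level v i).
Proof.
rewrite (_ : level v i = \bigcap_(e in [set: E]) (f e @^-1` [set v i e])).
  apply: fin_bigcap_measurable => [|e _]; first exact: finite_finset.
  by rewrite -[X in measurable X]setTI; exact: measurable_funPT.
by apply/seteqP; split=> [s sv e _|s sv e]; [exact: sv|exact: sv].
Qed.

Lemma level_expansion (G : (E -> R) -> R) s :
  G (fun e => f e s) = \sum_i G (v i) * \1_(level v i) s.
Proof.
have [i si] := v_cover s.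
rewrite (bigD1 i)//= indicE mem_set// mulr1 big1 ?addr0.
  by congr G; apply/funext.
move=> j ji; rewrite indicE memNset ?mulr0// => sj.
by move/eqP: ji; apply; apply: v_inj; apply/funext => e; rewrite -si -sj.
Qed.

Lemma Rintegral_level (m : {measure set S -> \bar R}) (G : (E -> R) -> R) :
  (m setT < +oo)%E ->
  \int[m]_s G (fun e => f e s) = \sum_i fine (m (level v i)) * G (v i).
Proof.
move=> moo.
have ii i : m.-integrable setT (EFin \o (fun s => \1_(level v i) s)).
  apply: (@bounded_integrable _ _ _ _ _ 1) => //.
    by apply: measurable_indic; exact: measurable_level.
  by move=> x; rewrite indicE; case: (_ \in _); rewrite ?normr1 ?normr0.
under eq_Rintegral do rewrite level_expansion.
rewrite (integrable_Rintegral_sum _ _).2; last first.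
  by move=> i; exact: (integrableZl measurableT (G (v i)) (ii i)).
apply: eq_bigr => i _; rewrite RintegralZl// mulrC; congr (_ * _).
by rewrite /Rintegral integral_indic ?setIT//; exact: measurable_level.
Qed.

Variables (nu : {measure set S -> \bar R}) (gamma : R) (y : E -> R).
Hypothesis f_le1 : forall e s, `|f e s| <= 1.
Hypothesis nuoo : (nu setT < +oo)%E.
Hypothesis nu0 : (nu setT != 0)%E.

Definition level_weight : 'I_n -> R := fun i => fine (nu (level v i)).

Definition gibbs_weight : 'I_n -> R := fun i =>
  level_weight i * expR (gamma * \sum_e y e * v i e).

Lemma level_weight_weight : weight level_weight.
Proof.
split; first by move=> i; rewrite fine_ge0.
have := Rintegral_level (fun=> 1) nuoo.
under [in RHS]eq_bigr do rewrite mulr1.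
move=> <-; rewrite /Rintegral integral_cst// mul1e fine_gt0//.
by rewrite nuoo andbT lt0e nu0/=.
Qed.

Lemma gibbs_weight_weight : weight gibbs_weight.
Proof.
have -> : gibbs_weight =
    tilt level_weight (fun i => \sum_e y e * v i e) gamma by [].
exact/tilt_weight/level_weight_weight.
Qed.

(** The Gibbs density is constant on each level set, so that the Gibbs measure of
a level set is its weight divided by the partition function. *)
Lemma gibbs_avg_level (G : (E -> R) -> R) :
  gibbs_avg nu gamma f y (fun s => G (fun e => f e s)) =
  wavg gibbs_weight (G \o v).
Proof.
have goo : (gibbs nu gamma f y setT < +oo)%E by rewrite gibbs_setT// ltry.
rewrite /gibbs_avg Rintegral_level//.
have ZE : partition_function nu gamma f y = \sum_i gibbs_weight i.
  exact: (Rintegral_level (fun x => expR (gamma * \sum_e y e * x e))).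
rewrite /wavg mulr_suml; apply: eq_bigr => i _.
suff -> : fine (gibbs nu gamma f y (level v i)) =
    gibbs_weight i / \sum_i gibbs_weight i by rewrite mulrAC.
rewrite -ZE /gibbs (eq_integral (cst (expR (gamma * \sum_e y e * v i e) /
    partition_function nu gamma f y)%:E)); last first.
  move=> s; rewrite inE => si; congr (expR (gamma * _) / _)%:E.
  by apply: eq_bigr => e _; rewrite si.
rewrite integral_cst; last exact: measurable_level.
have lfin : nu (level v i) \is a fin_num.
  rewrite ge0_fin_numE// (le_lt_trans _ nuoo)// le_measure ?inE//.
  exact: measurable_level.
by rewrite fineM//= /gibbs_weight /level_weight; ring.
Qed.

Lemma gibbs_variance_level (M := fun i => (\sum_e v i e) / #|E|%:R) :
  gibbs_variance_magnetization nu gamma f y = wcov gibbs_weight M M.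
Proof.
rewrite /gibbs_variance_magnetization.
have -> : gibbs_avg nu gamma f y (magnetization f) = wavg gibbs_weight M.
  exact: (gibbs_avg_level (fun x => (\sum_e x e) / #|E|%:R)).
set a := wavg _ _.
rewrite (gibbs_avg_level (fun x => ((\sum_e x e) / #|E|%:R - a) ^+ 2)).
rewrite (_ : _ \o v = fun i => M i * M i + ((- (2 * a)) * M i + a ^+ 2)).
  rewrite !wavgD wavgZ wavg_cst; last exact: gibbs_weight_weight.
  by rewrite /wcov -/a; ring.
by apply/funext => i; rewrite /= -/(M i); ring.
Qed.

End fixed_configurations.
End finite_gibbs.

(** * Approximate integration by parts *)

Section measurable_averages.
Context d (T : measurableType d) (R : realType) (n : nat).

Lemma measurable_wavg (r : T -> 'I_n -> R) (g : 'I_n -> R) :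
  (forall w, weight (r w)) -> (forall i, measurable_fun setT (r ^~ i)) ->
  measurable_fun setT (fun w => wavg (r w) g).
Proof.
(* the denominator is positive, so its inverse is a real power *)
move=> rw mr; rewrite (_ : (fun w => _) =
    (fun w => (\sum_i r w i * g i) * (\sum_i r w i) `^ (-1))); last first.
  by apply/funext => w; rewrite powR_inv1// ltW//; case: (rw w).
apply: measurable_funM.
  by apply: measurable_sum => i; exact: measurable_funM.
apply: (@measurableT_comp _ _ _ _ _ _ (fun x => x `^ (-1)) _
  (fun w => \sum_i r w i)); first exact: measurable_powR.
exact: measurable_sum.
Qed.

Lemma measurable_wcov (r : T -> 'I_n -> R) (f g : 'I_n -> R) :
  (forall w, weight (r w)) -> (forall i, measurable_fun setT (r ^~ i)) ->
  measurable_fun setT (fun w => wcov (r w) f g).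
Proof.
move=> rw mr; apply: measurable_funB; first exact: measurable_wavg.
by apply: measurable_funM; exact: measurable_wavg.
Qed.

Lemma measurable_tilt (r : T -> 'I_n -> R) (f : 'I_n -> R) (t : T -> R) i :
  measurable_fun setT t -> measurable_fun setT (r ^~ i) ->
  measurable_fun setT (fun w => tilt (r w) f (t w) i).
Proof.
move=> mt mr; apply: measurable_funM => //.
by apply: measurableT_comp => //; exact: measurable_funM.
Qed.

End measurable_averages.

Lemma Rintegral_probability_cst d (T : measurableType d) (R : realType)
    (P : probability T R) (c : R) : \int[P]_w c = c.
Proof.
rewrite Rintegral_cst//; have -> : fine (P setT) = 1 by rewrite probability_setT.
by rewrite mulr1.
Qed.

Section approximate_integration_by_parts.
Context d (T : measurableType d) (R : realType) (P : probability T R).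
Variables (G : set (set T)) (Y : {mfun T >-> R}).
Hypothesis G_measurable : <<s G >> `<=` measurable.
Hypothesis GY_independent : forall A B, <<s G >> A -> measurable B ->
  (P (A `&` Y @^-1` B) = P A * P (Y @^-1` B))%E.

Let mid : measurable_fun setT (id : T -> g_sigma_algebraType G).
Proof. by move=> _ A mA; rewrite setTI; exact: G_measurable. Qed.

Lemma sub_sigma_measurable_fun (X : T -> R) :
  measurable_fun setT (X : g_sigma_algebraType G -> R) ->
  measurable_fun setT X.
Proof. by move=> mX; exact: (measurableT_comp mX mid). Qed.

Lemma independent_centered (X : T -> R) (h : R -> R) (c : R) :
  measurable_fun setT (X : g_sigma_algebraType G -> R) ->
  (forall w, `|X w| <= c) ->
  measurable_fun setT h -> P.-integrable setT (EFin \o (h \o Y)) ->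
  \int[P]_w h (Y w) = 0 ->
  P.-integrable setT (EFin \o (fun w => X w * h (Y w))) /\
  \int[P]_w (X w * h (Y w)) = 0.
Proof.
move=> mX Xc mh ih h0.
pose U : {mfun T >-> g_sigma_algebraType G} := mfun_Sub (mem_set mid).
have iX : P.-integrable setT (EFin \o (X \o U)).
  apply: (bounded_integrable (c := c)) => //.
    by rewrite -ge0_fin_numE ?fin_num_measure.
  exact: sub_sigma_measurable_fun.
have ind A B : measurable A -> measurable B ->
    (P (U @^-1` A `&` Y @^-1` B) = P (U @^-1` A) * P (Y @^-1` B))%E.
  exact: GY_independent.
have [i ->] := independent_expectationM ind mX mh iX ih.
by split => //; rewrite h0 mulr0.
Qed.

(** The frozen weights [r] carry the randomness of everything but [Y].  After
adding the two expectations that vanish by independence, [E (c0 (1 - Y ^ 2))] and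
[E (F0 Y)], the inequality holds pointwise, and [rho] majorizes the error. *)
Lemma approximate_integration_by_parts n (r : T -> 'I_n -> R)
    (f g : 'I_n -> R) (gamma : R) (rho : R -> R) :
  0 < gamma ->
  (forall w, weight (r w)) ->
  (forall i, measurable_fun setT (r ^~ i : g_sigma_algebraType G -> R)) ->
  (forall i, `|f i| <= 1) -> (forall i, `|g i| <= 1) ->
  P.-integrable setT (EFin \o Y) -> \int[P]_w Y w = 0 ->
  P.-integrable setT (EFin \o (fun w => Y w ^+ 2)) ->
  \int[P]_w (Y w ^+ 2) = 1 ->
  (forall x, `|x| * Num.min (2 * `|gamma * x|) (3 * `|gamma * x| ^+ 2) +
    3 * gamma * `|gamma * x| <= rho x) ->
  P.-integrable setT (EFin \o (rho \o Y)) ->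
  gamma * \int[P]_w wcov (tilt (r w) f (gamma * Y w)) f g <=
  \int[P]_w (Y w * wavg (tilt (r w) f (gamma * Y w)) g) + \int[P]_w rho (Y w).
Proof.
move=> gamma0 rw mr f1 g1 iY EY iY2 EY2 rhoP irho.
have P1 : (P setT < +oo)%E by rewrite -ge0_fin_numE ?fin_num_measure.
have ione : P.-integrable setT (EFin \o (fun=> 1 : R)).
  by apply: (bounded_integrable (c := 1)) => // x; rewrite normr1.
have mr' i : measurable_fun setT (r ^~ i) by exact/sub_sigma_measurable_fun.
have tw w : weight (tilt (r w) f (gamma * Y w)) by exact: tilt_weight.
have mt i : measurable_fun setT (fun w => tilt (r w) f (gamma * Y w) i).
  by apply: measurable_tilt => //; exact: measurable_funM.
have icov : P.-integrable setT
    (EFin \o (fun w => wcov (tilt (r w) f (gamma * Y w)) f g)).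
  apply: (bounded_integrable (c := 1)) => //; first exact: measurable_wcov.
  by move=> w; exact: norm_wcov_le1.
have iYavg : P.-integrable setT
    (EFin \o (fun w => Y w * wavg (tilt (r w) f (gamma * Y w)) g)).
  apply: (le_integrable measurableT _ _ iY) => /=.
    apply/measurable_EFinP; apply: measurable_funM => //.
    exact: measurable_wavg.
  by move=> w _; rewrite lee_fin normrM ler_piMr// norm_wavg_le1.
have [|w||||i1 E1] := @independent_centered (fun w => wcov (r w) f g)
    (fun x => 1 - x ^+ 2) 1.
- exact: (@measurable_wcov _ (g_sigma_algebraType G)).
- exact: norm_wcov_le1.
- by apply: measurable_funB => //; exact: measurable_funX.
- exact: (integrableB measurableT ione iY2).
- rewrite RintegralB//.
  by rewrite EY2 Rintegral_probability_cst subrr.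
have [|w|//|||i2 E2] := @independent_centered (fun w => wavg (r w) g) id 1.
- exact: (@measurable_wavg _ (g_sigma_algebraType G)).
- exact: norm_wavg_le1.
- exact: iY.
- exact: EY.
have iD1 := integrableD measurableT iYavg irho.
have iB := integrableB measurableT iD1 i2.
have iZ := integrableZl measurableT gamma i1.
rewrite -RintegralZl//.
have -> : \int[P]_w (Y w * wavg (tilt (r w) f (gamma * Y w)) g) +
    \int[P]_w rho (Y w) =
    \int[P]_w (Y w * wavg (tilt (r w) f (gamma * Y w)) g + rho (Y w) -
      wavg (r w) g * Y w + gamma * (wcov (r w) f g * (1 - Y w ^+ 2))).
  rewrite RintegralD// RintegralB// RintegralD// RintegralZl//.
  by rewrite E1 E2 mulr0 subr0 addr0.
apply: le_Rintegral => //.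
- exact: (integrableZl measurableT gamma icov).
- exact: (integrableD measurableT iB iZ).
move=> w _; have := rhoP (Y w).
have := wavg_tilt_taylor (gamma * Y w) (rw w) f1 g1.
have := wcov_tilt_lipschitz (gamma * Y w) (rw w) f1 g1.
move: (wcov (tilt _ _ _) _ _) (wcov (r w) _ _) => c c0.
move: (wavg (tilt _ _ _) _) (wavg (r w) _) => F F0.
move: (Num.min _ _) => m; move: (Y w) => y clip Ftaylor rhoy.
have H1 : gamma * (c - c0) <= 3 * gamma * `|gamma * y|.
  by rewrite -mulrA mulrCA ler_pM2l// (le_trans (ler_norm _)).
have H2 : - (y * (F - F0 - c0 * (gamma * y))) <= `|y| * m.
  by rewrite (le_trans (ler_norm _))// normrN normrM ler_wpM2l.
by lra.
Qed.

End approximate_integration_by_parts.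

(** * The variance of the magnetization *)

Section disorder.
Context (R : realType) (dO dS : measure_display).
Context (Omega : measurableType dO) (S : measurableType dS).
Context (P : probability Omega R) (E : finType).
Variables (mu : R.-ftker Omega ~> S) (y : E -> {RV P >-> R}).
Hypothesis hindep : disorder_independent P mu y.
Hypothesis hmean : forall e, ('E_P[y e] = 0)%E.
Hypothesis hvar : forall e, ('V_P[y e] = 1)%E.

Let F (i : option E) : set (set Omega) :=
  if i is Some e then sigma_rv (y e) else sigma_random_measure mu.

(** Generates the joint sigma-algebra of [mu] and of the [y e'], [e' != e]. *)
Definition others (e : E) : set (set Omega) :=
  \bigcup_(i in [set i | i != Some e]) F i.

Let sigmaF i : sigma_algebra setT (F i).
Proof.
case: i => [e|]; last exact: smallest_sigma_algebra.
by apply: sigma_algebra_preimage; exact: sigma_algebra_measurable.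
Qed.

Let measurableF i : F i `<=` measurable.
Proof.
case: i => [e _ [B mB <-]|]; first exact: measurable_funPT.
apply: smallest_sub; first exact: sigma_algebra_measurable.
by move=> _ [U mU [B mB <-]]; exact: (measurable_kernel mu U mU).
Qed.

Lemma others_measurable e : <<s others e >> `<=` measurable.
Proof.
apply: smallest_sub; first exact: sigma_algebra_measurable.
by move=> A [i _]; exact: measurableF.
Qed.

Lemma others_independent e A B : <<s others e >> A -> measurable B ->
  (P (A `&` y e @^-1` B) = P A * P (y e @^-1` B))%E.
Proof.
move=> sA mB.
apply: (@mutually_independent_complement _ _ _ _ _ F (Some e)) => //.
by exists B => //; rewrite setTI.
Qed.

Lemma measurable_rv_others e e' : e' != e ->
  measurable_fun setT (y e' : g_sigma_algebraType (others e) -> R).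
Proof.
move=> ee' _ B mB; apply: sub_sigma_algebra; exists (Some e').
  by rewrite /=; apply: contra ee' => /eqP[->].
by exists B.
Qed.

Lemma measurable_measure_others e U : measurable U ->
  measurable_fun setT
    ((fun w => fine (mu w U)) : g_sigma_algebraType (others e) -> R).
Proof.
move=> mU; apply: (measurableT_comp (f := fine)); first exact: fine_measurable.
move=> _ B mB; apply: sub_sigma_algebra; exists None => //.
by apply: sub_sigma_algebra; exists U => //; exists B.
Qed.

Let second_moment e : (\int[P]_w (y e w ^+ 2)%:E = 1)%E.
Proof.
rewrite -(hvar e) /variance [in RHS]unlock hmean/= unlock.
by apply: eq_integral => w _; rewrite !fctE /= subr0 expr2.
Qed.

Lemma integrable_sqr e : P.-integrable setT (EFin \o (fun w => y e w ^+ 2)).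
Proof.
apply/integrableP; split.
  by apply/measurable_EFinP; exact: measurable_funX.
rewrite (eq_integral (fun w => (y e w ^+ 2)%:E)) ?second_moment ?ltry// => w _.
by rewrite /= ger0_norm// sqr_ge0.
Qed.

Lemma Rintegral_sqr e : \int[P]_w (y e w ^+ 2) = 1.
Proof. by rewrite /Rintegral second_moment. Qed.

Lemma integrable_rv e : P.-integrable setT (EFin \o y e).
Proof.
have ione : P.-integrable setT (EFin \o (fun=> 1 : R)).
  apply: (bounded_integrable (c := 1)) => //; last by move=> x; rewrite normr1.
  by rewrite -ge0_fin_numE ?fin_num_measure.
apply: (le_integrable measurableT _ _
  (integrableD measurableT ione (integrable_sqr e))).
  exact/measurable_EFinP.
move=> w _ /=; rewrite lee_fin [leRHS]ger0_norm ?addr_ge0 ?sqr_ge0//.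
have := sqr_ge0 (`|y e w| - 1).
by rewrite -(real_normK (num_real (y e w))); nra.
Qed.

Lemma Rintegral_rv e : \int[P]_w y e w = 0.
Proof. by rewrite /Rintegral; have := hmean e; rewrite unlock => ->. Qed.

Lemma uncorrelated e e' :
  P.-integrable setT (EFin \o (fun w => y e w * y e' w)) /\
  \int[P]_w (y e w * y e' w) = (e == e')%:R.
Proof.
case: eqP => [<-|/eqP ee'].
  by under eq_Rintegral do rewrite -expr2; split;
    [exact: integrable_sqr|exact: Rintegral_sqr].
have ind A B : measurable A -> measurable B ->
    (P (y e @^-1` A `&` y e' @^-1` B) = P (y e @^-1` A) * P (y e' @^-1` B))%E.
  move=> mA mB; apply: others_independent => //.
  by have := measurable_rv_others ee' measurableT mA; rewrite setTI.
have [//|//|i ->] := independent_expectationM ind (g := id) (h := id) _ _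
    (integrable_rv e) (integrable_rv e').
by split => //; rewrite !Rintegral_rv mulr0.
Qed.

Lemma Rintegral_sum_sqr :
  P.-integrable setT (EFin \o (fun w => (\sum_e y e w) ^+ 2)) /\
  \int[P]_w ((\sum_e y e w) ^+ 2) = #|E|%:R.
Proof.
have -> : (fun w => (\sum_e y e w) ^+ 2) =
    (fun w => \sum_e \sum_e' y e w * y e' w).
  apply/funext => w; rewrite expr2 mulr_suml; apply: eq_bigr => e _.
  by rewrite mulr_sumr.
have H e := @integrable_Rintegral_sum _ _ _ P _ (index_enum E) _
  (fun e' => (uncorrelated e e').1).
have [i ->] := @integrable_Rintegral_sum _ _ _ P _ (index_enum E) _
  (fun e => (H e).1).
split => //.
rewrite (eq_bigr (fun=> 1)) ?sumr_const ?cardT// => e _.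
rewrite (H e).2 (bigD1 e)//= (uncorrelated e e).2 eqxx big1 ?addr0// => e' ee'.
by rewrite (uncorrelated e e').2 eq_sym (negbTE ee').
Qed.

Variables (f : E -> {mfun S >-> R}) (gamma : R).
Hypothesis hS : finite_set [set: S].
Hypothesis hmu : forall w, (mu w [set: S] != 0)%E.
Hypothesis hf : forall e s, `|f e s| <= 1.
Hypothesis hE : (0 < #|E|)%N.
Hypothesis hgamma : 0 < gamma.

(** The variance of [M] is the average over [e] of the covariances of [f e] and
[M].  Integrating by parts in each [y e] leaves the expectation of [F] times the
sum of the [y e], which is at most [sqrt N], and the sum of the errors. *)
Lemma expected_variance_bound (rho : R -> R) :
  (forall x, `|x| * Num.min (2 * `|gamma * x|) (3 * `|gamma * x| ^+ 2) +
    3 * gamma * `|gamma * x| <= rho x) ->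
  (forall e, P.-integrable setT (EFin \o (rho \o y e))) ->
  ('E_P[fun w => gibbs_variance_magnetization (mu w) gamma f (y ^~ w)] <=
   ((gamma * #|E|%:R)^-1 * (\sum_e \int[P]_w rho (y e w)) +
     1 / (gamma * Num.sqrt #|E|%:R))%:E)%E.
Proof.
move=> rhoP irho.
have muoo w : (mu w setT < +oo)%E.
  by rewrite -ge0_fin_numE//; exact: kernel_finite_transition.
have [n [v [v_inj [v_cover v_level]]]] := finite_configurations f hS.
have v1 e i : `|v i e| <= 1 by have [s <-] := v_level i.
pose N : R := #|E|%:R; have N0 : 0 < N by rewrite ltr0n.
pose p w := level_weight f v (mu w).
have pw w : weight (p w) by exact: level_weight_weight.
pose W w := gibbs_weight f v (mu w) gamma (y ^~ w).
have Ww w : weight (W w) by exact: gibbs_weight_weight.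
(* the Gibbs weights with the coupling y e set to zero *)
pose r e w i := p w i * expR (gamma * \sum_(e' | e' != e) y e' w * v i e').
have rw e w : weight (r e w).
  have -> : r e w =
    tilt (p w) (fun i => \sum_(e' | e' != e) y e' w * v i e') gamma by [].
  exact: tilt_weight.
have Wr e w : W w = tilt (r e w) (v ^~ e) (gamma * y e w).
  apply/funext => i; rewrite /W /gibbs_weight /tilt /r -mulrA -expRD.
  by rewrite -mulrA -mulrDr (bigD1 e)//= addrC.
have mr e i : measurable_fun setT
    ((fun w => r e w i) : g_sigma_algebraType (others e) -> R).
  apply: measurable_funM.
    by apply: measurable_measure_others; exact: measurable_level.
  apply: measurableT_comp => //; apply: measurable_funM => //.
  under eq_fun do rewrite big_mkcond.
  apply: measurable_sum => e'; have [->|ee'] := eqVneq e' e => //=.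
  by apply: measurable_funM => //; exact: measurable_rv_others.
pose M i := (\sum_e v i e) / N.
have M1 i : `|M i| <= 1.
  rewrite normrM [`|_^-1|]gtr0_norm ?invr_gt0// ler_pdivrMr// mul1r.
  rewrite (le_trans (ler_norm_sum _ _ _))//.
  by rewrite (le_trans (ler_sum _ (fun e _ => v1 e i)))// sumr_const.
have mW i : measurable_fun setT (W ^~ i).
  have /card_gt0P[e _] := hE.
  rewrite (_ : W ^~ i =
      fun w => tilt (r e w) (v ^~ e) (gamma * y e w) i); last first.
    by apply/funext => w; rewrite (Wr e).
  apply: measurable_tilt; first exact: measurable_funM.
  exact: (sub_sigma_measurable_fun (@others_measurable e)).
have P1 : (P setT < +oo)%E by rewrite -ge0_fin_numE ?fin_num_measure.
have icov e : P.-integrable setT (EFin \o (fun w => wcov (W w) (v ^~ e) M)).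
  apply: (bounded_integrable (c := 1)) => //; first exact: measurable_wcov.
  by move=> w; exact: norm_wcov_le1.
have iyM e : P.-integrable setT (EFin \o (fun w => y e w * wavg (W w) M)).
  apply: (le_integrable measurableT _ _ (integrable_rv e)) => /=.
    apply/measurable_EFinP; apply: measurable_funM => //.
    exact: measurable_wavg.
  by move=> w _; rewrite lee_fin normrM ler_piMr// norm_wavg_le1.
have ibp e : gamma * \int[P]_w wcov (W w) (v ^~ e) M <=
    \int[P]_w (y e w * wavg (W w) M) + \int[P]_w rho (y e w).
  under eq_Rintegral do rewrite (Wr e).
  under [X in _ <= X + _]eq_Rintegral do rewrite (Wr e).
  apply: (approximate_integration_by_parts (@others_measurable e)) => //.
  - exact: others_independent.
  - exact: integrable_rv.
  - exact: Rintegral_rv.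
  - exact: integrable_sqr.
  - exact: Rintegral_sqr.
have [isum Esum] := integrable_Rintegral_sum (index_enum E) iyM.
have fluct : \sum_e \int[P]_w (y e w * wavg (W w) M) <= Num.sqrt N.
  rewrite -Esum.
  have [i2 E2] := Rintegral_sum_sqr.
  have s0 : 0 < Num.sqrt N by rewrite sqrtr_gt0.
  have i1 : P.-integrable setT (EFin \o (fun=> Num.sqrt N / 2)).
    exact: finite_measure_integrable_cst.
  have i3 := integrableZl measurableT (2 * Num.sqrt N)^-1 i2.
  (* |b| <= b ^ 2 / (2 sqrt N) + sqrt N / 2, with equality when b = sqrt N, the
     standard deviation of the sum of the y e *)
  apply: (@le_trans _ _ (\int[P]_w
      ((2 * Num.sqrt N)^-1 * (\sum_e y e w) ^+ 2 + Num.sqrt N / 2))).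
    apply: le_Rintegral => //; first exact: (integrableD measurableT i3 i1).
    move=> w _; rewrite -mulr_suml.
    have := norm_wavg_le1 (Ww w) M1; move: (wavg _ _) (\sum_e _) => a b a1.
    have ab : b * a <= `|b|.
      by rewrite (le_trans (ler_norm _))// normrM ler_piMr.
    rewrite (le_trans ab)// -subr_ge0 -(real_normK (num_real b)).
    rewrite (_ : _ - _ = (2 * Num.sqrt N)^-1 * (`|b| - Num.sqrt N) ^+ 2).
      by rewrite mulr_ge0 ?sqr_ge0// invr_ge0 mulr_ge0// ltW.
    by field; rewrite gt_eqF.
  rewrite RintegralD// RintegralZl// E2 Rintegral_probability_cst -/N.
  rewrite -{2}(sqr_sqrtr (ltW N0)) le_eqVlt; apply/orP; left; apply/eqP.
  by field; rewrite gt_eqF.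
have varE w : gibbs_variance_magnetization (mu w) gamma f (y ^~ w) =
    N^-1 * \sum_e wcov (W w) (v ^~ e) M.
  rewrite (gibbs_variance_level v_inj v_cover)// -/(W w) -/M -wcov_sumZl.
  by congr (wcov _ _ _); apply/funext => i; rewrite /M mulrC.
have [icsum Ecsum] := integrable_Rintegral_sum (index_enum E) icov.
have iN := integrableZl measurableT N^-1 icsum.
rewrite unlock; under eq_integral do rewrite varE.
rewrite -[leLHS]fineK; last exact: integrable_fin_num.
rewrite lee_fin -[leLHS]/(\int[P]_w (N^-1 * \sum_e wcov (W w) (v ^~ e) M)).
rewrite RintegralZl// Ecsum.
have : gamma * (\sum_e \int[P]_w wcov (W w) (v ^~ e) M) <=
    Num.sqrt N + \sum_e \int[P]_w rho (y e w).
  rewrite mulr_sumr (le_trans (ler_sum _ (fun e _ => ibp e)))//.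
  by rewrite big_split/= lerD2r.
rewrite -/N; move: (\sum_e _) (\sum_e _) => b a ab.
have s0 : 0 < Num.sqrt N by rewrite sqrtr_gt0.
rewrite -(ler_pM2l (mulr_gt0 hgamma N0)).
rewrite [leLHS](_ : _ = gamma * a); last by field; rewrite gt_eqF.
rewrite (le_trans ab)// le_eqVlt; apply/orP; left; apply/eqP.
have NE : N = Num.sqrt N ^+ 2 by rewrite sqr_sqrtr ?ltW.
move: (Num.sqrt N) NE s0 => s -> s0.
by field; rewrite !gt_eqF.
Qed.

End disorder.

(** * Estimates of the error term *)

Section error_estimates.
Context (R : realType) (dO : measure_display) (Omega : measurableType dO).
Context (P : probability Omega R) (Y : {RV P >-> R}) (gamma : R).
Hypothesis gamma0 : 0 < gamma.
Hypothesis iY2 : P.-integrable setT (EFin \o (fun w => Y w ^+ 2)).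
Hypothesis EY2 : \int[P]_w (Y w ^+ 2) = 1.

(** In both majorants the term [3 gamma ^ 2 |x|], coming from the increment of the
covariance, is replaced by [3 gamma ^ 2 (1 + x ^ 2) / 2], whose expectation is
known exactly. *)
Definition truncated_error (K x : R) : R :=
  2 * gamma * (`|x| ^+ 2 * \1_[set z | K <= `|z|] x) +
  (3 * gamma ^+ 2 * (K + 2^-1) * x ^+ 2 + 3 / 2 * gamma ^+ 2).

Definition cubic_error (x : R) : R :=
  3 * gamma ^+ 2 * `|x| ^+ 3 +
  (3 / 2 * gamma ^+ 2 * x ^+ 2 + 3 / 2 * gamma ^+ 2).

Lemma truncated_errorP K x : 0 <= K ->
  `|x| * Num.min (2 * `|gamma * x|) (3 * `|gamma * x| ^+ 2) +
    3 * gamma * `|gamma * x| <= truncated_error K x.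
Proof.
move=> K0; rewrite /truncated_error indicE !normrM gtr0_norm//.
rewrite -(real_normK (num_real x)).
set a := `|x|; have a0 : 0 <= a by exact: normr_ge0.
have g20 : 0 < gamma ^+ 2 by rewrite exprn_gt0.
have [g_small g_large] : Num.min (2 * (gamma * a)) (3 * (gamma * a) ^+ 2) <=
    2 * (gamma * a) /\
    Num.min (2 * (gamma * a)) (3 * (gamma * a) ^+ 2) <= 3 * (gamma * a) ^+ 2.
  by split; rewrite ge_min lexx ?orbT.
have lin : 3 * gamma * (gamma * a) <=
    3 * gamma ^+ 2 * 2^-1 * a ^+ 2 + 3 / 2 * gamma ^+ 2.
  have := mulr_ge0 (ltW g20) (sqr_ge0 (a - 1)); nra.
have [Ka|aK] := leP K a.
  rewrite mem_set//= mulr1.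
  have := ler_wpM2l a0 g_small.
  have : 0 <= 3 * gamma ^+ 2 * K * a ^+ 2.
    by rewrite mulr_ge0 ?sqr_ge0// mulr_ge0// mulr_ge0// ltW.
  by lra.
rewrite memNset /=; last by apply/negP; rewrite -ltNge.
rewrite mulr0 mulr0 add0r.
have := ler_wpM2l a0 g_large.
have : 3 * gamma ^+ 2 * a ^+ 2 * a <= 3 * gamma ^+ 2 * a ^+ 2 * K.
  by rewrite ler_wpM2l ?(ltW aK)// mulr_ge0 ?sqr_ge0// mulr_ge0// ltW.
by lra.
Qed.

Lemma cubic_errorP x :
  `|x| * Num.min (2 * `|gamma * x|) (3 * `|gamma * x| ^+ 2) +
    3 * gamma * `|gamma * x| <= cubic_error x.
Proof.
rewrite /cubic_error !normrM gtr0_norm// -(real_normK (num_real x)).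
set a := `|x|; have a0 : 0 <= a by exact: normr_ge0.
have g20 : 0 < gamma ^+ 2 by rewrite exprn_gt0.
have m_le : Num.min (2 * (gamma * a)) (3 * (gamma * a) ^+ 2) <=
    3 * (gamma * a) ^+ 2.
  by rewrite ge_min lexx orbT.
have := ler_wpM2l a0 m_le.
by have := mulr_ge0 (ltW g20) (sqr_ge0 (a - 1)); lra.
Qed.

Let icst (c : R) : P.-integrable setT (EFin \o (fun=> c)).
Proof. exact: finite_measure_integrable_cst. Qed.

Lemma integrable_tail (K : R) : P.-integrable setT
  (EFin \o (fun w => `|Y w| ^+ 2 * \1_[set w | K <= `|Y w|] w)).
Proof.
apply: (le_integrable measurableT _ _ iY2).
  apply/measurable_EFinP; apply: measurable_funM.
    by apply: measurable_funX; exact: measurableT_comp.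
  apply: measurable_indic.
  rewrite -[X in measurable X]setTI.
  rewrite (_ : [set w | K <= `|Y w|] = (fun w => `|Y w|) @^-1` `[K, +oo[).
    have mnY : measurable_fun setT (fun w => `|Y w|) by exact: measurableT_comp.
    exact: mnY.
  by apply/seteqP; split=> w /=; rewrite in_itv/= andbT.
move=> w _; rewrite lee_fin normrM normrX normr_id -normrX ler_piMr//.
by rewrite indicE; case: (_ \in _); rewrite ?normr1 ?normr0.
Qed.

Lemma Rintegral_truncated_error K :
  P.-integrable setT (EFin \o (truncated_error K \o Y)) /\
  \int[P]_w truncated_error K (Y w) =
  2 * gamma * \int[P]_w (`|Y w| ^+ 2 * \1_[set w | K <= `|Y w|] w) +
  3 * gamma ^+ 2 * (K + 1).
Proof.
have i1 := integrableZl measurableT (2 * gamma) (integrable_tail K).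
have i2 := integrableZl measurableT (3 * gamma ^+ 2 * (K + 2^-1)) iY2.
have i3 := icst (3 / 2 * gamma ^+ 2).
have i23 := integrableD measurableT i2 i3.
split; first exact: (integrableD measurableT i1 i23).
rewrite -[LHS]/(\int[P]_w
  (2 * gamma * (`|Y w| ^+ 2 * \1_[set w | K <= `|Y w|] w) +
  (3 * gamma ^+ 2 * (K + 2^-1) * Y w ^+ 2 + 3 / 2 * gamma ^+ 2))).
rewrite RintegralD// RintegralD// !RintegralZl//; last exact: integrable_tail.
by rewrite EY2 Rintegral_probability_cst; field.
Qed.

Hypothesis iY3 : P.-integrable setT (EFin \o (fun w => `|Y w| ^+ 3)).

Lemma Rintegral_cubic_error :
  P.-integrable setT (EFin \o (cubic_error \o Y)) /\
  \int[P]_w cubic_error (Y w) <= 6 * gamma ^+ 2 * \int[P]_w (`|Y w| ^+ 3).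
Proof.
(* integrate 2 y ^ 2 <= |y| ^ 3 + |y| and |y| <= (1 + y ^ 2) / 2 *)
have b1 : 1 <= \int[P]_w (`|Y w| ^+ 3).
  have i2 := integrableZl measurableT (3 / 2) iY2.
  have := @le_Rintegral _ _ _ P setT (fun w => 3 / 2 * Y w ^+ 2 + - 2^-1)
    (fun w => `|Y w| ^+ 3) measurableT.
  rewrite RintegralD// RintegralZl// EY2 Rintegral_probability_cst.
  move=> /(_ (integrableD measurableT i2 (icst (- 2^-1))) iY3) H.
  apply: le_trans (H _); first by lra.
  move=> w _; rewrite -(real_normK (num_real (Y w))).
  have := mulr_ge0 (normr_ge0 (Y w)) (sqr_ge0 (`|Y w| - 1)).
  by have := sqr_ge0 (`|Y w| - 1); lra.
have i1 := integrableZl measurableT (3 * gamma ^+ 2) iY3.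
have i2 := integrableZl measurableT (3 / 2 * gamma ^+ 2) iY2.
have i3 := icst (3 / 2 * gamma ^+ 2).
have i23 := integrableD measurableT i2 i3.
split; first exact: (integrableD measurableT i1 i23).
rewrite RintegralD// RintegralD// !RintegralZl//.
rewrite EY2 Rintegral_probability_cst.
have g20 : 0 <= gamma ^+ 2 by rewrite sqr_ge0.
by have := ler_wpM2l g20 b1; lra.
Qed.

End error_estimates.

(** * The theorem *)

Theorem theorem1 (R : realType) (dO dS : measure_display)
    (Omega : measurableType dO) (S : measurableType dS)
    (P : probability Omega R) (E : finType)
    (mu : R.-ftker Omega ~> S) (f : E -> {mfun S >-> R})
    (y : E -> {RV P >-> R}) (gamma : R)
    (hS : finite_set [set: S])
    (hmu : forall w, (mu w [set: S] != 0)%E)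
    (hf : forall e s, `|f e s| <= 1)
    (hindep : disorder_independent P mu y)
    (hmean : forall e, ('E_P[y e] = 0)%E)
    (hvar : forall e, ('V_P[y e] = 1)%E)
    (hE : (0 < #|E|)%N)
    (hgamma : 0 < gamma) :
  let lhs : \bar R := 'E_P[fun w =>
    gibbs_variance_magnetization (mu w) gamma f (fun e => y e w)]%E in
  let err : R := 1 / (gamma * Num.sqrt #|E|%:R) in
  (forall K : R, 1 <= K ->
    let I : \bar R := ((8 / #|E|%:R)%R%:E *
        (\sum_(e : E) expectation_on P (fun w => (`|y e w| ^+ 2)%R)
                        [set w | (K <= `|y e w|)%R])
      + (9 * gamma * K)%R%:E)%E in
    (lhs <= I + err%:E)%E) /\
  (let B3 : \bar R :=
    (\big[maxe/-oo]_(e : E) 'E_P[fun w => (`|y e w| ^+ 3)%R])%E in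
    (B3 < +oo)%E ->
    (lhs <= 9%R%:E * B3 * gamma%:E + err%:E)%E).
Proof.
move=> lhs err.
have iy2 := integrable_sqr hmean hvar; have Ey2 := Rintegral_sqr hmean hvar.
have N0 : 0 < #|E|%:R :> R by rewrite ltr0n.
have bound := expected_variance_bound hindep hmean hvar hS hmu hf hE hgamma.
split=> [K K1|B3 B3oo].
- cbv zeta; have K0 : 0 <= K by rewrite (le_trans ler01).
  have Erho e := Rintegral_truncated_error gamma (iy2 e) (Ey2 e) K.
  apply: (le_trans (bound _ (fun x => truncated_errorP hgamma x K0)
    (fun e => (Erho e).1))).
  pose tail e := \int[P]_w (`|y e w| ^+ 2 * \1_[set w | K <= `|y e w|] w).
  have tailE e : expectation_on P (fun w => `|y e w| ^+ 2)
      [set w | K <= `|y e w|] = (tail e)%:E.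
    rewrite /expectation_on unlock /tail /Rintegral fineK//.
    exact: integrable_fin_num (integrable_tail (iy2 e) K).
  have tail0 : 0 <= \sum_e tail e.
    apply: sumr_ge0 => e _; apply: Rintegral_ge0 => w _.
    by rewrite mulr_ge0// indicE; case: (_ \in _).
  rewrite (eq_bigr _ (fun e _ => tailE e)) sumEFin -EFinM -!EFinD lee_fin.
  rewrite lerD2r (eq_bigr _ (fun e _ => (Erho e).2)) big_split/=.
  rewrite -mulr_sumr -/tail.
  rewrite sumr_const cardT -cardE -mulr_natl.
  move: (\sum_e _) tail0 => t t0.
  rewrite [leLHS](_ : _ = 2 / #|E|%:R * t + 3 * gamma * (K + 1)); last first.
    by field; rewrite !gt_eqF.
  apply: lerD; first by rewrite ler_wpM2r// mulr1 ler_pM2r ?invr_gt0//; lra.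
  have gK : gamma <= gamma * K by rewrite ler_peMr// ltW.
  by lra.
- have leB3 e : ('E_P[fun w => (`|y e w| ^+ 3)%R] <= B3)%E by exact: le_bigmax.
  have /card_gt0P[e0 _] := hE.
  have E0 e : (0 <= 'E_P[fun w => (`|y e w| ^+ 3)%R])%E.
    by apply: expectation_ge0 => w; rewrite exprn_ge0.
  have B3fin : B3 \is a fin_num.
    by rewrite ge0_fin_numE//; exact: le_trans (E0 e0) (leB3 e0).
  have iy3 e : P.-integrable setT (EFin \o (fun w => `|y e w| ^+ 3)).
    apply/integrableP; split.
      apply/measurable_EFinP; apply: measurable_funX.
      exact: measurableT_comp.
    apply: le_lt_trans B3oo; apply: le_trans (leB3 e).
    rewrite unlock le_eqVlt; apply/orP; left; apply/eqP.
    by apply: eq_integral => w _; rewrite /= ger0_norm// exprn_ge0.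
  have Erho e := Rintegral_cubic_error gamma (iy2 e) (Ey2 e) (iy3 e).
  apply: (le_trans (bound _ (cubic_errorP hgamma) (fun e => (Erho e).1))).
  have Eb e : \int[P]_w (`|y e w| ^+ 3) <= fine B3.
    rewrite /Rintegral fine_le//; first exact: integrable_fin_num (iy3 e).
    by have := leB3 e; rewrite unlock.
  rewrite -(fineK B3fin) -!EFinM -EFinD lee_fin lerD2r.
  move: (fine B3) Eb => b Eb.
  have g20 : 0 < gamma ^+ 2 by rewrite exprn_gt0.
  have b0 : 0 <= b.
    by apply: le_trans (Eb e0); apply: Rintegral_ge0 => w _; rewrite exprn_ge0.
  apply: (@le_trans _ _
    ((gamma * #|E|%:R)^-1 * \sum_(e : E) (6 * gamma ^+ 2 * b))).
    apply: ler_wpM2l; first by rewrite invr_ge0 ltW// mulr_gt0.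
    apply: ler_sum => e _; apply: le_trans (Erho e).2 _.
    by apply: ler_wpM2l (Eb e); rewrite mulr_ge0// ltW.
  rewrite sumr_const cardT -cardE -mulr_natl.
  rewrite [leLHS](_ : _ = 6 * b * gamma); last by field; rewrite !gt_eqF.
  by have := mulr_ge0 b0 (ltW hgamma); lra.
Qed.
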